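(* Let $1<p<\infty$. Let $\Omega=\bigcup_{j\in\mathbb N}I_j\subset\mathbb R$, where the $I_j$ are pairwise disjoint bounded open intervals, and let $h\in G_d$ for some $d>1$. Let $g(x)=h^{-1}(1/x)$ and $f(x)=1/h(1/x)$, and let $N(\lambda,\Omega)$ be the eigenvalue counting function of $-(|u'|^{p-2}u')'=\lambda|u|^{p-2}u$ in $\Omega$ with zero Dirichlet boundary conditions on $\partial\Omega$. Then: (1) if $|I_j|\asymp g(j)$ as $j\to\infty$, then $N(\lambda,\Omega)=O\big(f(\lambda^{1/p})\big)$ as $\lambda\to+\infty$; (2) if $|I_j|\sim g(j)$ as $j\to\infty$, then $$N(\lambda,\Omega)=\frac{\zeta(d)}{\pi_p^d}f(\lambda^{1/p})+o\big(f(\lambda^{1/p})\big)\qquad\text{as }\lambda\to+\infty.$$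
   Context: For $d>1$, $G_d$ is the class of continuous functions $h:(0,\infty)\to(0,\infty)$ such that: (i) $h$ is strictly increasing, $\lim_{x\to0^+}h(x)=0$ and $\lim_{x\to\infty}h(x)=\infty$; (ii) for every $t>0$, $\lim_{x\to0^+}h(tx)/h(x)=t^d$, uniformly for $t$ in compact subsets of $(0,\infty)$; (iii) $\lim_{x\to0^+}h(x)/x=0$. $\mathbb N=\{1,2,3,\dots\}$, $|I_j|$ is the length of $I_j$, and $\zeta$ is the Riemann zeta function. $a_j\sim b_j$ means $a_j/b_j\to1$; $a_j\asymp b_j$ means $c\,b_j\le a_j\le C\,b_j$ for all large $j$ with some constants $c,C>0$. The constant $\pi_p$ is $\pi_p=2(p-1)^{1/p}\int_0^1\frac{ds}{(1-s^p)^{1/p}}$. The Dirichlet eigenvalues of the $p$-Laplacian problem $-(|u'|^{p-2}u')'=\lambda|u|^{p-2}u$ on an interval of length $T$ are $\lambda_k=\pi_p^pk^p/T^p$, $k\in\mathbb N$. For a disjoint union $\Omega=\bigcup_j I_j$ of intervals, $N(\lambda,\Omega)$ is the number of eigenvalues less than or equal to $\lambda$, counted so that $N(\lambda,\Omega)=\sum_{j=1}^\infty N(\lambda,I_j)$, where $N(\lambda,I_j)=\#\{k\in\mathbb N:\pi_p^pk^p/|I_j|^p\le\lambda\}$. (The measure of $\Omega$ may be infinite.) *)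

(* Defs.v *)
From mathcomp Require Import all_boot all_order all_algebra.
From mathcomp Require Import all_classical all_reals all_analysis.

Set Implicit Arguments.
Unset Strict Implicit.
Unset Printing Implicit Defensive.

Import Order.TTheory GRing.Theory Num.Theory.
Import numFieldNormedType.Exports.

Local Open Scope classical_set_scope.
Local Open Scope ring_scope.

(* Lets the Landau notations be used with the filter of neighborhoods of +oo. *)
Canonical pinfty_filter_on (R : realType) := FilterType (pinfty_nbhs R) _.

(* A function h : (0,oo) -> (0,oo) is represented by a total h : R -> R; only
   its values on `]0, +oo[ are constrained or used. *)
Record G_class (R : realType) (d : R) (h : R -> R) : Prop := {
  G_pos : forall x, 0 < x -> 0 < h x ;
  G_continuous : {in `]0, +oo[, continuous h} ;
  G_increasing : {in `]0, +oo[ &, {homo h : x y / x < y}} ;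
  G_lim0 : h x @[x --> 0^'+] --> 0 ;
  G_limoo : h x @[x --> +oo] --> +oo ;
  G_regular : forall t, 0 < t -> h (t * x) / h x @[x --> 0^'+] --> t `^ d ;
  G_regular_unif : forall K : set R, compact K -> K `<=` `]0, +oo[ ->
    {uniform K, (fun x t => h (t * x) / h x) @ 0^'+ --> (fun t => t `^ d)} ;
  G_sublinear : h x / x @[x --> 0^'+] --> 0 }.

Definition g_of (R : realType) (h : R -> R) (x : R) : R :=
  'pinv_(fun=> 0) `]0, +oo[ h (1 / x).

Definition f_of (R : realType) (h : R -> R) (x : R) : R := 1 / h (1 / x).

Definition asymp_order (R : realType) (a b : R ^nat) : Prop :=
  exists c C : R, [/\ 0 < c, 0 < C &
    \forall j \near \oo, c * b j <= a j /\ a j <= C * b j].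

Definition asymp_equiv (R : realType) (a b : R ^nat) : Prop :=
  a j / b j @[j --> \oo] --> (1 : R).

(* riemannR d n = 1 / (n+1)^d, so this is \sum_(n >= 1) 1 / n^d; it is the
   Riemann zeta function for real d > 1. *)
Definition zeta (R : realType) (d : R) : R := limn (series (riemannR d)).

Definition pi_p (R : realType) (p : R) : R :=
  2 * (p - 1) `^ (1 / p) *
  \int[lebesgue_measure]_(s in `]0, 1[) (1 / (1 - s `^ p) `^ (1 / p)).

Definition bounded_open_interval (R : realType) (I : set R) : Prop :=
  exists a b : R, a < b /\ I = `]a, b[%classic.

Definition len (R : realType) (I : set R) : R := fine (lebesgue_measure I).

Definition plap_eigenvalue (R : realType) (p : R) (I : set R) (k : nat) : R :=
  pi_p p `^ p * k%:R `^ p / len I `^ p.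

Definition N_interval (R : realType) (p lambda : R) (I : set R) : \bar R :=
  counting [set k : nat | (0 < k)%N /\ plap_eigenvalue p I k <= lambda].

(* Counting function of Omega = \bigcup_(j >= 1) I j, for disjoint I j. *)
Definition N_union (R : realType) (p lambda : R) (I : nat -> set R) : \bar R :=
  (\sum_(1 <= j <oo) N_interval p lambda (I j))%E.

(* Main.v *)
(**
Write x = lambda^(1/p).  Each interval contributes floor(x |I_j| / pi_p)
eigenvalues, so after replacing |I_j| by a constant multiple of g(j) one has to
count the pairs (j, k) with k <= x g(j).  Since g inverts 1/h, this condition
reads j <= 1/h(k/x); summing over j first turns the count into a series over k
whose terms are 1/h(k/x) up to a bounded error.  Multiplied by h(1/x), the k-th
term tends to k^(-d) by regular variation and is dominated by a constant times
k^(-a) with 1 < a < d (Potter), so the series tends to zeta(d) by dominated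
convergence.  The finitely many intervals not controlled by g contribute O(x),
which is o(1/h(1/x)) because h(y)/y tends to 0.
*)
Require Import Defs.
From mathcomp Require Import all_boot all_order all_algebra.
From mathcomp Require Import all_classical all_reals all_analysis.
From mathcomp Require Import measurable_realfun.
From mathcomp Require Import lra.
Import Order.TTheory GRing.Theory Num.Theory.
Import numFieldNormedType.Exports.
Local Open Scope classical_set_scope.
Local Open Scope ring_scope.
Set Implicit Arguments.
Unset Strict Implicit.
Unset Printing Implicit Defensive.

(** * Series: the zeta series and dominated convergence *)

(* S_n <= S_(2n+1) <= 1 + 2^(1-a) S_n bounds the partial sums. *)
Lemma cvg_series_riemannR {R : realType} (a : R) :
  1 < a -> cvgn (series (riemannR a)).
Proof.
move=> a1; have a0 : 0 <= a by lra.
have r0 n : 0 <= riemannR a n by apply/ltW/riemannR_gt0.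
set q : R := (2 `^ a)^-1.
have q0 : 0 < q by rewrite invr_gt0 powR_gt0.
have q1 : 2 * q < 1.
  rewrite /q ltr_pdivrMr ?powR_gt0// mul1r.
  rewrite -[ltLHS]powRr1// /powR pnatr_eq0/= ltr_expR ltr_pM2r//.
  by rewrite ln_gt0// ltr1n.
have rS m n : (m <= n)%N -> riemannR a n <= riemannR a m.
  move=> mn; rewrite /riemannR lef_pV2 ?posrE ?powR_gt0//.
  by rewrite ge0_ler_powR ?nnegrE// ler_nat.
have rdbl n : riemannR a n.*2.+1 = q * riemannR a n.
  rewrite /riemannR -invfM -powRM//; congr ((_ `^ _)^-1).
  by rewrite -natrM mul2n doubleS.
have S2 n : series (riemannR a) n.*2.+1 <= 1 + 2 * q * series (riemannR a) n.
  elim: n => [|n ih].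
    by rewrite seriesEnat /= big_nat1 big_geq// mulr0 addr0 /riemannR powR1 invr1.
  rewrite doubleS seriesS seriesS (seriesS _ n).
  have := rdbl n; have := rS _ _ (leqnSn n.*2.+1); rewrite rdbl; lra.
apply: nondecreasing_is_cvgn; first exact: nondecreasing_series.
exists (1 - 2 * q)^-1 => _ [n _ <-].
rewrite -[leRHS]div1r ler_pdivlMr; last lra.
have : series (riemannR a) n <= series (riemannR a) n.*2.+1.
  by apply: nondecreasing_series => //; rewrite -addnn; apply: leqW; exact: leq_addr.
have := S2 n; nra.
Qed.

(** The series of v - u has nonnegative terms, so its partial sums stay below its limit; the same
    holds for u. *)
Lemma series_tail_le {R : realType} (u v : R ^nat) n :
  (forall k, 0 <= u k <= v k) -> cvgn (series v) ->
  0 <= limn (series u) - series u n <= limn (series v) - series v n.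
Proof.
move=> uv cv; have u0 k : 0 <= u k by case/andP: (uv k).
have uv' k : u k <= v k by case/andP: (uv k).
have v0 k : 0 <= v k by exact: le_trans (uv' k).
have cu : cvgn (series u) by exact: series_le_cvg cv.
have H (w : R ^nat) : (forall k, 0 <= w k) -> cvgn (series w) ->
    series w n <= limn (series w).
  by move=> w0 cw; apply: nondecreasing_cvgn_le => //; exact: nondecreasing_series.
have := H _ u0 cu.
have E : series (v - u) = series v - series u.
  by apply/funext => k; rewrite /series/= !fctE sumrB.
have : series (v - u) n <= limn (series (v - u)).
  apply: H => [k|]; first by rewrite !fctE subr_ge0.
  by rewrite E; exact: is_cvgB.
rewrite E limB// !fctE; lra.
Qed.

(** Dominated convergence for series along a proper filter. Cut where the tail of [b] is at most
    e/3: the tails of [f t] and [l] are then as small, and the finite heads converge. *)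
Lemma tannery {R : realType} {T : Type} (F : set_system T) {FF : ProperFilter F}
    (f : T -> R ^nat) (l b : R ^nat) :
  cvgn (series b) -> (\forall t \near F, forall k, 0 <= f t k <= b k) ->
  (forall k, f t k @[t --> F] --> l k) ->
  limn (series (f t)) @[t --> F] --> limn (series l).
Proof.
move=> cb fb fl.
have lb k : 0 <= l k <= b k.
  have fk : cvg (f t k @[t --> F]) by apply/cvg_ex; exists (l k).
  rewrite -(cvg_lim (@Rhausdorff R) (fl k)); apply/andP; split.
    by apply: limr_ge => //; apply: filterS fb => t /(_ k)/andP[].
  by apply: limr_le => //; apply: filterS fb => t /(_ k)/andP[].
apply/cvgrPdist_le => e e0.
have e3 : 0 < e / 3 by lra.
have [n _ /(_ n (leqnn n))] : \forall n \near \oo,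
    `|limn (series b) - series b n| <= e / 3.
  by move/cvgrPdist_le : cb; exact.
rewrite /= => bn.
have fn : series (f t) n @[t --> F] --> series l n.
  by apply: cvg_big => [|i _]; [exact: add_continuous|exact: fl].
move/cvgrPdist_le : fn => /(_ _ e3) fn.
apply: filterS2 fb fn => t fb fn.
have := series_tail_le n fb cb; have := series_tail_le n lb cb.
move: bn fn; rewrite !ler_norml => /andP[? ?] /andP[? ?] /andP[? ?] /andP[? ?].
by apply/andP; split; lra.
Qed.

(** * Counting integers, and the eigenvalues of one interval *)

Lemma sum_nat_ltn (m n b : nat) : (m <= n)%N -> (b <= n)%N ->
  (\sum_(m <= j < n) (j < b)%N)%N = (b - m)%N.
Proof.
move=> mn bn.
have [mb|bm] := leqP m b.
  rewrite (big_cat_nat mb bn) /= (eq_big_nat _ _ (F2 := fun=> 1%N)); last first.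
    by move=> i /andP[_ ->].
  rewrite sum_nat_const_nat muln1 big_nat_cond big1 ?addn0//.
  by move=> i /andP[/andP[+ _] _]; rewrite ltnNge => ->.
rewrite big_nat_cond big1; first by apply/esym/eqP; rewrite subn_eq0 ltnW.
by move=> i /andP[/andP[+ _] _] => /(leq_trans (ltnW bm)); rewrite ltnNge => ->.
Qed.

(** The partial sums are constant from max(m, floor(y) + 1) on. Truncated subtraction gives 0 when
    no j >= m satisfies j <= y. *)
Lemma nneseries_count_le {R : realType} (y : R) m : 0 <= y ->
  (\sum_(m <= j <oo) (j%:R <= y)%R%:R%:E = ((Num.truncn y).+1 - m)%:R%:E :> \bar R)%E.
Proof.
move=> y0; apply: cvg_lim => //.
apply: cvg_near_cst.
exists (maxn m (Num.truncn y).+1) => // n /=.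
rewrite geq_max => /andP[mn yn].
rewrite sumEFin -natr_sum -(sum_nat_ltn mn yn); congr (_%:R%:E).
by apply: eq_bigr => j _; rewrite ltnS truncn_ge_nat.
Qed.

Lemma counting_le {R : realType} (y : R) : 0 <= y ->
  counting [set k : nat | (0 < k)%N /\ k%:R <= y] = (Num.truncn y)%:R%:E :> \bar R.
Proof.
move=> y0; rewrite counting_dirac.
transitivity (\sum_(1 <= j <oo) (j%:R <= y)%R%:R%:E : \bar R)%E; last first.
  by rewrite nneseries_count_le// subn1.
(* The index 0 carries no mass because of the condition 0 < k. *)
rewrite nneseries_recl//=.
rewrite [X in (X + _)%E](_ : _ = 0%E) ?add0e; last first.
  by rewrite diracE memNset// => -[].
rewrite [LHS]eseries_cond [RHS]eseries_cond.
apply: eq_eseriesr => -[//|i _].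
rewrite diracE; congr (_%:R%:E); congr nat_of_bool.
by apply/idP/idP => [/set_mem[]//|?]; apply/mem_set.
Qed.

Lemma powR_inv_root {R : realType} (p x : R) : 0 < p -> 0 <= x -> (x `^ (1 / p)) `^ p = x.
Proof. by move=> p0 x0; rewrite -powRrM divfK ?gt_eqF// powRr1. Qed.

Lemma len_gt0 {R : realType} (I : set R) : bounded_open_interval I -> 0 < len I.
Proof.
move=> [a [b [ab ->]]]; rewrite /len lebesgue_measure_itv/= lte_fin ab/=.
by rewrite subr_gt0.
Qed.

(** Since t^p is increasing in t >= 0, taking p-th roots turns the eigenvalue condition into k <=
    lambda^(1/p) |I| / pi_p. *)
Lemma N_intervalE {R : realType} (p lambda : R) (I : set R) :
  0 < p -> 0 < pi_p p -> 0 <= lambda -> 0 < len I ->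
  N_interval p lambda I = (Num.truncn (lambda `^ (1 / p) / pi_p p * len I))%:R%:E.
Proof.
move=> p0 pi0 l0 I0.
rewrite -counting_le; last by rewrite mulr_ge0 ?divr_ge0 ?powR_ge0 ?ltW.
rewrite /N_interval; congr counting; apply/seteqP; rewrite /plap_eigenvalue.
have E k : (pi_p p `^ p * k%:R `^ p / len I `^ p <= lambda)
   = (k%:R <= lambda `^ (1 / p) / pi_p p * len I).
  rewrite ler_pdivrMr ?powR_gt0// -{1}(powR_inv_root p0 l0).
  rewrite -!powRM ?powR_ge0 ?(ltW pi0) ?(ltW I0)//.
  rewrite [in RHS]mulrAC ler_pdivlMr// [in RHS]mulrC.
  have lk0 : pi_p p * k%:R \in Num.nneg by rewrite nnegrE mulr_ge0// ltW.
  have ll0 : lambda `^ (1 / p) * len I \in Num.nneg.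
    by rewrite nnegrE mulr_ge0 ?powR_ge0// ltW.
  apply/idP/idP; last by apply: (ge0_ler_powR (ltW p0)).
  by apply: contraTT; rewrite -!ltNge; exact: gt0_ltr_powR.
by split => k /= [k0]; rewrite E.
Qed.

(** * The class G_d: inversion of h and Potter's bound *)

Section G.
Context {R : realType} (d : R) (h : R -> R).
Context (hh : G_class d h).

Lemma G_le x y : 0 < x -> 0 < y -> (h x <= h y) = (x <= y).
Proof.
have hlt u v : 0 < u -> 0 < v -> u < v -> h u < h v.
  by move=> u0 v0; apply: (G_increasing hh); rewrite in_itv/= ?u0 ?v0.
move=> x0 y0; have [xy|yx|->] := ltgtP x y; last exact: lexx.
  by rewrite ltW// hlt.
by apply/negbTE; rewrite -ltNge hlt.
Qed.

(** The limits of h at 0 and at infinity bracket y; the intermediate value theorem does the rest. *)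
Lemma G_surj y : 0 < y -> exists2 x, 0 < x & h x = y.
Proof.
move=> y0.
have [a [a0 ha]] : exists a, 0 < a /\ h a < y.
  near ((0 : R)^'+) => a; exists a; split => //.
  by near: a; exact: (cvgr_lt _ (G_lim0 hh)).
have [b [ab hb]] : exists b, a < b /\ y < h b.
  near +oo_R => b; exists b; split; first by near: b; by apply: nbhs_pinfty_gt; exact: num_real.
  by near: b; move/cvgryPgt : (G_limoo hh) => /(_ y).
have b0 : 0 < b by apply: lt_trans ab.
have [||c] := @IVT _ h a b y (ltW ab).
- apply: continuous_in_subspaceT => x /set_mem /= xab; apply: (G_continuous hh).
  by move: xab; rewrite !in_itv/= andbT => /andP[+ _]; exact: lt_le_trans.
- have hab : h a <= h b by rewrite G_le// ltW.
  by rewrite min_l// max_r// !ltW.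
rewrite in_itv/= => /andP[ac _] <-; exists c => //; exact: lt_le_trans ac.
Unshelve. all: by end_near. Qed.

(** The partial inverse is meaningful only on the image of h, with default value 0 elsewhere. For j
    > 0, [G_surj] puts 1/j in that image. *)
Lemma g_of_spec j : (0 < j)%N -> 0 < g_of h j%:R /\ h (g_of h j%:R) = j%:R^-1.
Proof.
move=> j0; rewrite /g_of div1r.
have : ([set h x | x in `]0, +oo[]) (j%:R^-1).
  have [|x x0 <-] := @G_surj (j%:R^-1); first by rewrite invr_gt0 ltr0n.
  by exists x => //=; rewrite in_itv/= x0.
move=> him; split; last by rewrite pinvK//; exact/mem_set.
have : 'pinv_(fun=> 0) `]0, +oo[ h (j%:R^-1) \in `]0, +oo[%classic.
  apply/mem_set; 
  have := @surjpinv_image_sub _ _ (fun=> 0) `]0, +oo[%classic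
    (h @` `]0, +oo[%classic) h.
  by apply => [//|]; exists (j%:R^-1).
by move/set_mem; rewrite /= in_itv/= andbT.
Qed.

(** Apply the increasing h and pass to reciprocals. This allows the pairs (j, k) with k <= x g(j) to
    be counted over j for each fixed k. *)
Lemma g_of_ge x j : 0 < x -> (0 < j)%N -> (x <= g_of h j%:R) = (j%:R <= (h x)^-1).
Proof.
move=> x0 j0; have [g0 hg] := g_of_spec j0.
have hx0 := G_pos hh x0.
by rewrite -G_le// hg -[in RHS]lef_pV2 ?posrE ?invr_gt0 ?ltr0n// invrK.
Qed.

(* Potter's lower bound, from iterating h (2 x) >= 2^a h x. *)
Lemma G_potter a : a < d -> 0 <= a -> exists2 x0, 0 < x0 &
  forall x k, 0 < x -> (0 < k)%N -> k%:R * x <= x0 ->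
    (k%:R / 2) `^ a * h x <= h (k%:R * x).
Proof.
move=> ad a0.
(* As a < d, the limit 2^d of the ratio strictly exceeds 2^a. *)
have : \forall x \near 0^'+, 2 `^ a < h (2 * x) / h x.
  apply: (cvgr_gt _ (G_regular hh _)); first by rewrite ltr0n.
  by rewrite /powR pnatr_eq0/= ltr_expR ltr_pM2r// ln_gt0// ltr1n.
move=> [e /= e0 he]; exists (e / 2); first by rewrite divr_gt0.
have pow n x : 0 < x -> (2 ^ n)%:R * x <= e / 2 ->
    (2 ^ n)%:R `^ a * h x <= h ((2 ^ n)%:R * x).
  move=> x0; elim: n => [_|n ih]; first by rewrite expn0 powR1 !mul1r.
  have n0 : 0 < (2 ^ n)%:R * x by rewrite mulr_gt0// ltr0n expn_gt0.
  rewrite expnS natrM -mulrA => ne.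
  have {}ih : (2 ^ n)%:R `^ a * h x <= h ((2 ^ n)%:R * x) by apply: ih; lra.
  have : 2 `^ a < h (2 * ((2 ^ n)%:R * x)) / h ((2 ^ n)%:R * x).
    apply: he => //=; rewrite sub0r normrN gtr0_norm//; lra.
  rewrite ltr_pdivlMr ?(G_pos hh)// powRM ?ler0n// -mulrA => /ltW; apply: le_trans.
  by rewrite ler_pM2l// powR_gt0.
move=> x k x0 k0 kx.
(* From 2^n <= k < 2^(n+1), k/2 < 2^n: rounding k down to a power of 2 is what costs the factor
   2^-a. *)
have /andP[nk kn] := trunc_log_bounds (isT : 1 < 2)%N k0.
set n := trunc_log 2 k in nk kn.
have n0 : 0 < (2 ^ n)%:R * x by rewrite mulr_gt0// ltr0n expn_gt0.
have nkx : (2 ^ n)%:R * x <= k%:R * x by rewrite ler_pM2r// ler_nat.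
have kx0 : 0 < k%:R * x by exact: lt_le_trans nkx.
apply: (@le_trans _ _ (h ((2 ^ n)%:R * x))); last by rewrite G_le.
apply: le_trans (pow _ _ x0 (le_trans nkx kx)).
rewrite ler_pM2r ?(G_pos hh)//; apply: ge0_ler_powR => //; rewrite ?nnegrE// ?divr_ge0//.
by rewrite ler_pdivrMr// -natrM ler_nat mulnC -expnS ltnW.
Qed.

End G.


(** * Positivity of pi_p *)

(* The real-valued integral would turn a divergent integral into 0, so
   integrability is part of the claim: cut `[0, 1[ at the points 1 - 2^-n and
   use s^p <= s to bound the integrand on each piece. *)
Lemma pi_p_gt0 {R : realType} (p : R) : 1 < p -> 0 < pi_p p.
Proof.
move=> p1; have p0 : 0 < p by lra.
pose f : measurableTypeR R -> R := fun s => 1 / (1 - s `^ p) `^ (1 / p).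
have fE : f = (fun s => (1 - s `^ p) `^ (- (1 / p))).
  by apply/funext => s; rewrite /f powRN div1r.
have mf (D : set (measurableTypeR R)) : measurable_fun D (EFin \o f).
  apply/measurable_EFinP; rewrite fE; apply: measurable_funTS.
  apply: (measurableT_comp (@measurable_powR R _)).
  by apply: measurable_funB => //; exact: measurable_powR.
have f0 s : 0 <= f s by rewrite fE powR_ge0.
have sp s : 0 <= s < 1 -> s `^ p <= s.
  move=> /andP[s0 s1]; have [->|sn0] := eqVneq s 0; first by rewrite powR0// gt_eqF.
  by rewrite ge1r_powR ?(ltW p1)// lt_neqAle eq_sym sn0 s0 ltW.
set r := p^-1; have r0 : 0 < r by rewrite invr_gt0.
have r11 : 1 `^ r = 1 by rewrite powR1.
have r1 : r < 1 by rewrite invf_lt1.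
pose e n : R := 1 - 2^-1 ^+ n.
have e2 n : 0 < 2^-1 ^+ n :> R by rewrite exprn_gt0// invr_gt0.
pose A n : set (measurableTypeR R) := `[e n, e n.+1[%classic.
have fA n s : A n s -> f s <= (2 ^+ n.+1) `^ r.
  rewrite /A /= in_itv/= => /andP[es se].
  have s0 : 0 <= s.
    by apply: le_trans es; rewrite subr_ge0 exprn_ile1// ?invr_ge0// invf_le1// ler1n.
  have s1 : s < 1 by apply: lt_le_trans se _; rewrite gerBl ltW.
  (* Here 1 - s^p >= 1 - s > 2^-(n+1). *)
  have H : 2^-1 ^+ n.+1 <= 1 - s `^ p.
    by have := sp s; rewrite s0 s1 => /(_ isT); rewrite /e in se; lra.
  have -> : (2 ^+ n.+1) `^ r = ((2^-1 ^+ n.+1) `^ r)^-1.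
    by rewrite -powRN -[in RHS]mulN1r powRrM powR_inv1 ?(ltW (e2 _))// exprVn invrK.
  rewrite /f !div1r.
  rewrite lef_pV2 ?posrE ?powR_gt0//; last exact: lt_le_trans H.
  by rewrite ge0_ler_powR ?nnegrE ?(ltW r0)// ltW//; apply: lt_le_trans H.
have cup : `[0, 1[%classic = \bigcup_n A n.
  apply/seteqP; split => [s|s [n _]]; rewrite /A /= !in_itv/=; last first.
    move=> /andP[es se]; apply/andP; split.
      by apply: le_trans es; rewrite subr_ge0 exprn_ile1// ?invr_ge0// invf_le1// ler1n.
    by apply: lt_le_trans se _; rewrite gerBl ltW.
  move=> /andP[s0 s1].
  (* The least such n is positive, since e 0 = 0 <= s, and its predecessor indexes the piece
     containing s. *)
  have : exists n, s < e n.
    have : (fun n => geometric 1 2^-1 n : R) @ \oo --> 0.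
      by apply: cvg_geometric; rewrite gtr0_norm// invf_lt1// ltr1n.
    move=> /(cvgr_lt 0)/(_ (1 - s)); rewrite subr_gt0 => /(_ s1) [n _ /(_ n (leqnn n))] /=.
    by rewrite mul1r => ?; exists n; rewrite /e; lra.
  move=> exn; have [[|n]] := ex_minnP exn; first by rewrite /e expr0 subrr ltNge s0.
  move=> sn min; exists n => //=; rewrite in_itv/= sn andbT leNgt.
  by apply/negP => /min; rewrite ltnn.
(* The integrand is at least 1 on ]0, 1[. *)
have lo : (1 <= \int[lebesgue_measure]_(s in `]0%R, 1%R[) (f s)%:E)%E.
  apply: (@le_trans _ _ (\int[lebesgue_measure]_(s in `]0%R, 1%R[) (cst 1 s))%E).
    by rewrite integral_cst//= lebesgue_measure_itv/= lte_fin ltr01 mul1e -EFinB subr0.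
  apply: ge0_le_integral => //=.
  move=> s; rewrite in_itv/= => /andP[s0 s1]; rewrite lee_fin /f !div1r.
  have s1' : s `^ p < 1 by apply: (le_lt_trans _ s1); apply: sp; rewrite (ltW s0) s1.
  rewrite invf_ge1 ?powR_gt0 ?subr_gt0// -[leRHS]r11.
  rewrite ge0_ler_powR ?nnegrE ?(ltW r0) ?subr_ge0 ?(ltW s1')//.
  by rewrite gerBl powR_ge0.
have hi : (\int[lebesgue_measure]_(s in `]0%R, 1%R[) (f s)%:E < +oo)%E.
  apply: (@le_lt_trans _ _ (\int[lebesgue_measure]_(s in `[0%R, 1%R[) (f s)%:E)%E).
    apply: ge0_subset_integral => //.
    - by move=> s _; rewrite lee_fin.
    - exact: subset_itvW.
  rewrite cup ge0_integral_bigcup//; last first.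
  - apply: ltn_trivIset => m n mn; apply/seteqP; split => // s; rewrite /A /= !in_itv/=.
    move=> [/andP[_ se] /andP[es _]].
    have : e n.+1 <= e m.
      by rewrite /e lerB// ler_wiXn2l// ?invr_ge0 ?invf_le1 ?ler1n.
    by move=> /le_trans/(_ es); rewrite leNgt se.
  - by move=> s _; rewrite lee_fin.
  - by move=> n; exact: measurable_itv.
  (* The piece [A n] has length 2^-(n+1) and the integrand is at most 2^((n+1)r) there, so it
     contributes at most q^(n+1); q < 1 because r = 1/p < 1. *)
  pose q : R := 2 `^ r / 2.
  apply: (@le_lt_trans _ _ (\sum_(0 <= n <oo) (geometric q q n)%:E)%E).
    apply: lee_nneseries.
      by move=> n _ _; apply: integral_ge0 => s _; rewrite lee_fin.
    move=> n _; apply: (@le_trans _ _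
      (\int[lebesgue_measure]_(s in A n) (cst ((2 ^+ n.+1) `^ r)%:E s))%E).
      apply: ge0_le_integral => //=.
      - exact: measurable_itv.
      - by move=> s _; rewrite lee_fin.
      - by move=> s sA; rewrite lee_fin; exact: fA.
    rewrite integral_cst/=; last exact: measurable_itv.
    have en : e n.+1 - e n = 2^-1 ^+ n.+1 by rewrite /e exprS; lra.
    rewrite lebesgue_measure_itv/= lte_fin -subr_gt0 en e2 -EFinB en -EFinM lee_fin.
    rewrite -powR_mulrn// powRAC powR_mulrn ?powR_ge0// -exprMn -/q.
    by rewrite exprS.
  rewrite (_ : (fun n => _) = EFin \o series (geometric q q)); last first.
    by apply/funext => n; rewrite /= seriesEnat/= sumEFin.
  rewrite EFin_lim ?ltry//; apply: is_cvg_geometric_series.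
  rewrite gtr0_norm ?divr_gt0 ?powR_gt0// ltr_pdivrMr// mul1r.
  rewrite -[ltRHS]powRr1// /powR pnatr_eq0/= ltr_expR ltr_pM2r//.
  by rewrite ln_gt0// ltr1n.
rewrite /pi_p !mulr_gt0// ?powR_gt0 ?subr_gt0//.
rewrite /Rintegral; apply: fine_gt0; rewrite hi andbT; exact: lt_le_trans lo.
Qed.

(** * Changes of variable at infinity *)

Lemma cvg_inv_pinfty {R : realType} : x^-1 @[x --> +oo_R] --> (0 : R)^'+.
Proof.
move=> P [e /= e0 eP]; suff : \forall x \near +oo_R, P x^-1 by [].
near=> x.
have x0 : 0 < x by near: x; apply: nbhs_pinfty_gt; exact: num_real.
apply: eP => /=; last by rewrite invr_gt0.
rewrite sub0r normrN gtr0_norm ?invr_gt0// invf_plt ?posrE//.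
by near: x; apply: nbhs_pinfty_gt; exact: num_real.
Unshelve. all: by end_near. Qed.

Lemma cvg_scale_pinfty {R : realType} (c : R) : 0 < c -> c * x @[x --> +oo] --> +oo.
Proof.
move=> c0; apply/cvgryPge => A; near=> x.
rewrite mulrC -ler_pdivrMr//; near: x; apply: nbhs_pinfty_ge; exact: num_real.
Unshelve. all: by end_near. Qed.

Lemma cvg_powR_pinfty {R : realType} (r : R) : 0 < r -> x `^ r @[x --> +oo] --> +oo.
Proof.
move=> r0; apply/cvgryPge => A; near=> x.
apply: (le_trans (ler_norm A)).
have -> : `|A| = (`|A| `^ r^-1) `^ r by rewrite -powRrM mulVf ?gt_eqF// powRr1.
have x0 : `|A| `^ r^-1 <= x by near: x; apply: nbhs_pinfty_ge; exact: num_real.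
by apply: (ge0_ler_powR (ltW r0)) => //; rewrite nnegrE ?powR_ge0// (le_trans _ x0)// powR_ge0.
Unshelve. all: by end_near. Qed.

Lemma cvg_powR_base {R : realType} (d t : R) : 0 < t -> s `^ d @[s --> t] --> t `^ d.
Proof.
move=> t0; have : differentiable (fun s : R => s `^ d) t.
  by apply/derivable1_diffP; apply: derivable_powR; rewrite in_itv/= t0.
exact: differentiable_continuous.
Qed.

(** * Asymptotics of the count for the lengths g(j) *)

Section asymptotics.
Context {R : realType} (d : R) (h : R -> R).
Context (hd : 1 < d) (hh : G_class d h).

Lemma cvg_G_inv : h x^-1 @[x --> +oo] --> 0.
Proof. exact: (cvg_comp _ _ cvg_inv_pinfty (G_lim0 hh)). Qed.

Lemma cvg_G_inv_sublinear : x * h x^-1 @[x --> +oo] --> 0.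
Proof.
have := cvg_comp _ _ cvg_inv_pinfty (G_sublinear hh).
by apply: cvg_trans; apply: near_eq_cvg; near=> x; rewrite /= invrK mulrC.
Unshelve. all: by end_near. Qed.

Lemma cvg_G_ratio s : 0 < s -> h x^-1 / h (s * x^-1) @[x --> +oo] --> (s `^ d)^-1.
Proof.
move=> s0.
have := cvg_comp _ _ cvg_inv_pinfty (G_regular hh s0).
move=> /(cvgV (lt0r_neq0 (powR_gt0 d s0))).
by apply: cvg_trans; apply: near_eq_cvg; near=> x; rewrite /= invf_div.
Unshelve. all: by end_near. Qed.

(** Number of pairs (j, k) with j >= m, k >= 1 and k <= x g(j). Starting at a large m confines k/x
    to the range where Potter's bound holds. *)
Definition tail_count (m : nat) (x : R) : \bar R :=
  (\sum_(m <= j <oo) (Num.truncn (x * g_of h j%:R))%:R%:E)%E.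

(** Write each floor as a sum of indicators over k and interchange the nonnegative sums: for fixed
    k, j runs from m to floor(1/h(k/x)). *)
Lemma tail_countE m x : (0 < m)%N -> 0 < x -> tail_count m x =
  (\sum_(0 <= k <oo) ((Num.truncn (h (k.+1%:R * x^-1))^-1).+1 - m)%:R%:E)%E.
Proof.
move=> m0 x0; rewrite /tail_count -nneseries_addn; last by move=> i; rewrite lee_fin.
transitivity (\sum_(0 <= i <oo) \sum_(0 <= k <oo)
    (k.+1%:R * x^-1 <= g_of h (i + m)%:R)%R%:R%:E : \bar R)%E.
  apply: eq_eseriesr => i _.
  have [g0 _] := g_of_spec hh (leq_trans m0 (leq_addl i m)).
  rewrite -[in LHS](succnK (Num.truncn _)) -subn1.
  rewrite -nneseries_count_le ?mulr_ge0 ?(ltW x0) ?(ltW g0)//.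
  rewrite -(@nneseries_addn _ (fun k => (k%:R <= x * g_of h (i + m)%:R)%R%:R%:E)); last first.
    by move=> ?; rewrite lee_fin.
  by apply: eq_eseriesr => k _; rewrite addn1 ler_pdivrMr// mulrC.
rewrite nneseries_interchange; last by move=> *; rewrite lee_fin.
apply: eq_eseriesr => k _.
have k0 : 0 < k.+1%:R * x^-1 by rewrite mulr_gt0 ?invr_gt0.
rewrite -nneseries_count_le ?invr_ge0 ?ltW ?(G_pos hh)//.
rewrite -[RHS]nneseries_addn; last by move=> ?; rewrite lee_fin.
apply: eq_eseriesr => i _; rewrite (g_of_ge hh)//.
exact: leq_trans m0 (leq_addl i m).
Qed.

Lemma tail_count_cvg : exists m0, forall m, (m0 <= m)%N ->
  (\forall x \near +oo, tail_count m x \is a fin_num) /\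
  h x^-1 * fine (tail_count m x) @[x --> +oo] --> zeta d.
Proof.
(* a < d is required by Potter's bound, a > 1 by the summability of k^-a. *)
have [a ad a1] : exists2 a, a < d & 1 < a by exists ((1 + d) / 2); rewrite midf_lt.
have a0 : 0 <= a by rewrite ltW// (lt_trans ltr01).
have [x0 x00 potter] := G_potter hh ad a0.
(* This makes m > 1/h(x0), so a nonzero k-th term forces h(k/x) <= h(x0), that is k/x <= x0. *)
exists (Num.truncn (h x0)^-1).+1 => m m0m.
have m0 : (0 < m)%N by exact: leq_trans m0m.
have hm : (h x0)^-1 < m%:R by rewrite -truncn_lt_nat// invr_ge0 ltW// (G_pos hh).
pose c x k : R := ((Num.truncn (h (k.+1%:R * x^-1))^-1).+1 - m)%:R.
(* The factor 2^a compensates the k/2 in [G_potter]. *)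
pose b : R ^nat := 2 `^ a *: riemannR a.
have cb : cvgn (series b) by apply: is_cvg_seriesZ; exact: cvg_series_riemannR.
have b0 k : 0 <= b k by rewrite /b fctE mulr_ge0 ?powR_ge0// ltW// riemannR_gt0.
have kx_gt0 x k : 0 < x -> 0 < k.+1%:R * x^-1 :> R by move=> ?; rewrite mulr_gt0 ?invr_gt0.
(* Since m >= 1, subtracting m absorbs the successor. *)
have c_le x k : 0 < x -> c x k <= (h (k.+1%:R * x^-1))^-1.
  move=> x_gt0; have h0 := G_pos hh (kx_gt0 x k x_gt0).
  have : (Num.truncn (h (k.+1%:R * x^-1))^-1)%:R <= (h (k.+1%:R * x^-1))^-1.
    by rewrite truncn_le invr_ge0 ltW.
  by apply: le_trans; rewrite ler_nat leq_subLR -add1n leq_add2r.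
have c_ge x k : 0 < x -> (h (k.+1%:R * x^-1))^-1 - m%:R <= c x k.
  move=> x_gt0; have := truncnS_gt (h (k.+1%:R * x^-1))^-1.
  move=> /ltW /le_trans hle; rewrite lerBlDr; apply: hle.
  by rewrite -natrD ler_nat addnC -leq_subLR.
have cle x k : 0 < x -> 0 <= h x^-1 * c x k <= b k.
  move=> x_gt0; have hx0 : 0 < h x^-1 by rewrite (G_pos hh) ?invr_gt0.
  rewrite mulr_ge0 ?(ltW hx0)//=.
  have [->|ck] := eqVneq (c x k) 0; first by rewrite mulr0.
  have h0 := G_pos hh (kx_gt0 x k x_gt0).
  have kx : k.+1%:R * x^-1 <= x0.
    rewrite -(G_le hh)//; last exact: kx_gt0.
    rewrite -[leRHS]invrK -[leLHS]invrK
      lef_pV2 ?posrE ?invr_gt0 ?(G_pos hh)//; last exact: kx_gt0.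
    apply: (le_trans (ltW hm)); rewrite -truncn_ge_nat ?invr_ge0 ?ltW//.
    by move: ck; rewrite /c pnatr_eq0 subn_eq0 -ltnNge ltnS.
  have := potter x^-1 k.+1; rewrite invr_gt0 => /(_ x_gt0 isT kx) pk.
  apply: (le_trans (ler_wpM2l (ltW hx0) (c_le x k x_gt0))).
  rewrite ler_pdivrMr// /b fctE /= /riemannR.
  have ka : 0 < k.+1%:R `^ a :> R by rewrite powR_gt0.
  have t2 : 0 < 2 `^ a :> R by rewrite powR_gt0.
  move: pk; rewrite powRM ?invr_ge0// -[2^-1]powR_inv1// -powRrM mulN1r powRN.
  rewrite mulrAC ler_pdivrMr// => pk.
  rewrite -[leRHS]/(2 `^ a * (k.+1%:R `^ a)^-1 * h (k.+1%:R / x)).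
  by rewrite mulrAC ler_pdivlMr// mulrC [leRHS]mulrC.
have ccvg x : 0 < x -> cvgn (series (c x)).
  move=> x_gt0; have hx0 : 0 < h x^-1 by rewrite (G_pos hh) ?invr_gt0.
  have -> : c x = (h x^-1)^-1 *: (h x^-1 *: c x) by rewrite scalerA mulVf ?gt_eqF// scale1r.
  apply: is_cvg_seriesZ; apply: (@series_le_cvg _ _ b) => // k; by have /andP[] := cle x k x_gt0.
have TE x : 0 < x -> tail_count m x = (limn (series (c x)))%:E.
  move=> x_gt0; rewrite tail_countE// -EFin_lim; last exact: ccvg.
  by apply/congr_lim/funext => n /=; rewrite seriesEnat/= sumEFin.
have pos : \forall x \near +oo, 0 < x :> R by apply: nbhs_pinfty_gt; exact: num_real.
split; first by apply: filterS pos => x /TE ->.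
have : limn (series (h x^-1 *: c x)) @[x --> +oo] --> zeta d.
  apply: (tannery cb); first by apply: filterS pos => x x_gt0 k; exact: cle.
  move=> k.
  have lim1 := cvg_G_ratio (ltr0n R k.+1 : 0 < k.+1%:R).
  (* The error of at most m per term vanishes after multiplication by h(1/x), m being fixed. *)
  have lim2 : h x^-1 / h (k.+1%:R * x^-1) - h x^-1 * m%:R @[x --> +oo] --> riemannR d k.
    rewrite -[X in _ --> X]subr0 -[X in _ --> _ - X](mul0r m%:R).
    apply: cvgB => //; apply: cvgMr_tmp; exact: cvg_G_inv.
  apply: (squeeze_cvgr _ lim2 lim1); apply: filterS pos => x x_gt0.
  have hx0 : 0 < h x^-1 by rewrite (G_pos hh) ?invr_gt0.
  by rewrite fctE -mulrBr !ler_wpM2l ?(ltW hx0) ?c_le ?c_ge.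
apply: cvg_trans; apply: near_eq_cvg; apply: filterS pos => x x_gt0 /=.
by rewrite TE//= lim_seriesZ//; exact: ccvg.
Qed.

End asymptotics.

(** * Comparison of general lengths with g(j) *)

Section sums.
Context {R : realType} (d : R) (h : R -> R).
Context (hd : 1 < d) (hh : G_class d h).

(** Substitute c x for x; regular variation gives h(1/x) / h(1/(c x)) -> c^d. *)
Lemma tail_count_scale_cvg : exists m0, forall m c, (m0 <= m)%N -> 0 < c ->
  (\forall x \near +oo, tail_count h m (c * x) \is a fin_num) /\
  h x^-1 * fine (tail_count h m (c * x)) @[x --> +oo] --> c `^ d * zeta d.
Proof.
have [m0 hm0] := tail_count_cvg hd hh; exists m0 => m c m0m c0.
have toy := cvg_scale_pinfty c0.
have [fin lim] := hm0 m m0m; split; first exact: (toy _ fin).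
have lim1 := cvg_comp _ _ toy lim.
have := cvg_G_ratio hh (_ : 0 < c^-1); rewrite invr_gt0 => /(_ c0) lim2.
have cd : (c^-1 `^ d)^-1 = c `^ d.
  by rewrite -[c^-1]powR_inv1 ?(ltW c0)// -powRrM mulN1r powRN invrK.
rewrite cd in lim2; have /(_ _) := cvgM lim2 lim1.
apply: cvg_trans; apply: near_eq_cvg; near=> x => /=.
have x0 : 0 < x by near: x; apply: nbhs_pinfty_gt; exact: num_real.
have cx0 : 0 < h (c^-1 * x^-1) by apply: (G_pos hh); rewrite mulr_gt0 ?invr_gt0.
by rewrite invfM mulrA divfK ?gt_eqF.
Unshelve. all: by end_near. Qed.

Context (l : R ^nat).
Context (l0 : forall j, (0 < j)%N -> 0 <= l j).

(** With l j = |I_j| / pi_p and x = lambda^(1/p), this is N(lambda, Omega). *)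
Definition total_count (x : R) : \bar R :=
  (\sum_(1 <= j <oo) (Num.truncn (x * l j))%:R%:E)%E.

(** The terms before m contribute at most L x, negligible since x h(1/x) -> 0. The later ones are at
    most those of [tail_count] at c x, which also yields finiteness. *)
Lemma total_count_le (c e : R) : 0 < c -> 0 < e ->
  (\forall j \near \oo, l j <= c * g_of h j%:R) ->
  \forall x \near +oo, total_count x \is a fin_num /\
    h x^-1 * fine (total_count x) <= c `^ d * zeta d + e.
Proof.
move=> c0 e0 [n _ ln].
have [m0 hm0] := tail_count_scale_cvg.
pose m := (maxn n m0).+1.
have [fin lim] := hm0 m c (leqW (leq_maxr n m0)) c0.
set L := \sum_(1 <= j < m) l j.
have limL : L * (x * h x^-1) + h x^-1 * fine (tail_count h m (c * x)) @[x --> +oo]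
    --> L * 0 + c `^ d * zeta d.
  apply: cvgD => //; apply: cvgMl_tmp; exact: cvg_G_inv_sublinear hh.
rewrite mulr0 add0r in limL.
have lt_e : c `^ d * zeta d < c `^ d * zeta d + e by rewrite ltrDl.
near=> x.
have x0 : 0 < x by near: x; apply: nbhs_pinfty_gt; exact: num_real.
have hx0 : 0 < h x^-1 by rewrite (G_pos hh) ?invr_gt0.
have finx : tail_count h m (c * x) \is a fin_num by near: x.
have le : (total_count x <= (x * L + fine (tail_count h m (c * x)))%:E)%E.
  rewrite /total_count (@nneseries_split _ _ 1 (maxn n m0)); last first.
    by move=> k _; rewrite lee_fin.
  rewrite add1n EFinD fineK//; apply: leeD.
    rewrite sumEFin lee_fin mulr_sumr; apply: ler_sum_nat => j /andP[j0 _].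
    by rewrite truncn_le mulr_ge0 ?(ltW x0)// l0.
  rewrite [leLHS]eseries_cond [leRHS]eseries_cond.
  apply: lee_nneseries => [j _ _|j /= mj]; first by rewrite lee_fin.
  rewrite lee_fin ler_nat le_truncn// -mulrA mulrCA ler_pM2l//; apply: ln.
  by rewrite /= (leq_trans (leq_maxl n m0))// ltnW.
have fint : total_count x \is a fin_num.
  rewrite ge0_fin_numE; first exact: le_lt_trans le (ltry _).
  by apply: nneseries_ge0 => *; rewrite lee_fin.
split=> //.
apply: (@le_trans _ _ (h x^-1 * (x * L + fine (tail_count h m (c * x))))).
  by rewrite ler_pM2l// -lee_fin fineK.
rewrite mulrDr mulrA mulrC [h _ * x]mulrC.
by near: x; apply: filterS (cvgr_lt _ limL _ lt_e) => x /ltW.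
Unshelve. all: by end_near. Qed.

(** Drop the nonnegative terms before m. Finiteness is a premise because [fine] sends +oo to 0. *)
Lemma total_count_ge (c e : R) : 0 < c -> 0 < e ->
  (\forall j \near \oo, c * g_of h j%:R <= l j) ->
  \forall x \near +oo, total_count x \is a fin_num ->
    c `^ d * zeta d - e <= h x^-1 * fine (total_count x).
Proof.
move=> c0 e0 [n _ ln].
have [m0 hm0] := tail_count_scale_cvg.
pose m := (maxn n m0).+1.
have [fin lim] := hm0 m c (leqW (leq_maxr n m0)) c0.
have lt_e : c `^ d * zeta d - e < c `^ d * zeta d by rewrite gtrBl.
near=> x => fint.
have x0 : 0 < x by near: x; apply: nbhs_pinfty_gt; exact: num_real.
have hx0 : 0 < h x^-1 by rewrite (G_pos hh) ?invr_gt0.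
have finx : tail_count h m (c * x) \is a fin_num by near: x.
apply: (@le_trans _ _ (h x^-1 * fine (tail_count h m (c * x)))).
  by near: x; apply: filterS (cvgr_gt _ lim _ lt_e) => x /ltW.
rewrite ler_pM2l// -lee_fin !fineK//.
rewrite /total_count (@nneseries_split _ _ 1 (maxn n m0)); last first.
  by move=> k _; rewrite lee_fin.
rewrite add1n -[leLHS]add0e; apply: leeD.
  by rewrite sumEFin lee_fin; apply: sumr_ge0.
rewrite [leLHS]eseries_cond [leRHS]eseries_cond.
apply: lee_nneseries => [j _ _|j /= mj]; first by rewrite lee_fin.
rewrite lee_fin ler_nat le_truncn// -mulrA mulrCA ler_pM2l//; apply: ln.
by rewrite /= (leq_trans (leq_maxl n m0))// ltnW.
Unshelve. all: by end_near. Qed.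

Lemma total_count_cvg (c : R) : 0 < c ->
  l j / g_of h j%:R @[j --> \oo] --> c ->
  (\forall x \near +oo, total_count x \is a fin_num) /\
  h x^-1 * fine (total_count x) @[x --> +oo] --> c `^ d * zeta d.
Proof.
move=> c0 lg.
have gpos : \forall j \near \oo, 0 < g_of h j%:R.
  by exists 1%N => // j /= /(g_of_spec hh)[].
have up a : c < a -> \forall j \near \oo, l j <= a * g_of h j%:R.
  move=> ca; apply: filterS2 gpos (cvgr_lt _ lg _ ca) => j g0 /ltW.
  by rewrite ler_pdivrMr.
have lo a : a < c -> \forall j \near \oo, a * g_of h j%:R <= l j.
  move=> ca; apply: filterS2 gpos (cvgr_gt _ lg _ ca) => j g0 /ltW.
  by rewrite ler_pdivlMr.
split.
  have c2 : c < c + 1 by rewrite ltrDl.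
  have := total_count_le (lt_trans c0 c2) ltr01 (up _ c2).
  by apply: filterS => x [].
apply/cvgrPdist_le => e e0.
have e2 : 0 < e / 2 by rewrite divr_gt0.
(* Continuity of s^d at c provides constants on both sides of c, at a cost of e/2; the counting
   bounds cost the other e/2. The term c / 2 in the minimum keeps u positive. *)
have [u [v [u0 uc cv hu hv]]] : exists u v, [/\ 0 < u, u < c, c < v,
    `|c `^ d * zeta d - u `^ d * zeta d| <= e / 2 &
    `|c `^ d * zeta d - v `^ d * zeta d| <= e / 2].
  have : s `^ d * zeta d @[s --> c] --> c `^ d * zeta d.
    by apply: cvgMr_tmp; exact: cvg_powR_base.
  move=> /cvgrPdist_le /(_ _ e2) [r /= r0 hr].
  pose t := Num.min (r / 2) (c / 2).
  have t0 : 0 < t by rewrite lt_min !divr_gt0.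
  have tr : t < r by rewrite gt_min ltr_pdivrMr// ltr_pMr// ltr1n.
  have tc : t < c by rewrite gt_min [X in _ || X]ltr_pdivrMr// ltr_pMr// ltr1n orbT.
  exists (c - t), (c + t); split.
  - by rewrite subr_gt0.
  - by rewrite gtrBl.
  - by rewrite ltrDl.
  - by apply: hr; rewrite /= opprB addrC subrK gtr0_norm.
  - by apply: hr; rewrite /= opprD addNKr normrN gtr0_norm.
have v0 : 0 < v by exact: lt_trans cv.
apply: filterS2 (total_count_le v0 e2 (up _ cv)) (total_count_ge u0 e2 (lo _ uc)).
move=> x [fint le] /(_ fint) ge.
move: hu hv; rewrite !ler_norml => /andP[hu1 hu2] /andP[hv1 hv2].
apply/andP; split; lra.
Qed.

End sums.

(** * The eigenvalue counting function of the union *)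

Lemma N_unionE {R : realType} (p lambda : R) (I : nat -> set R) :
  1 < p -> (forall j, (0 < j)%N -> bounded_open_interval (I j)) ->
  0 <= lambda ->
  N_union p lambda I =
  total_count (fun j => len (I j) / pi_p p) (lambda `^ (1 / p)).
Proof.
move=> hp I_itv lambda0; have pi0 := pi_p_gt0 hp.
rewrite /N_union /total_count [LHS]eseries_cond [RHS]eseries_cond.
apply: eq_eseriesr => j /= j0.
rewrite N_intervalE ?(lt_trans _ hp) ?len_gt0//; last exact: I_itv.
by rewrite mulrA mulrAC.
Qed.

Theorem theorem5p3 (R : realType) (p d : R) (h : R -> R) (I : nat -> set R)
    (hp : 1 < p) (hd : 1 < d) (hh : G_class d h)
    (I_itv : forall j, (0 < j)%N -> bounded_open_interval (I j))
    (I_disj : trivIset [set j | (0 < j)%N] I) :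
  (asymp_order (fun j => len (I j)) (fun j => g_of h j%:R) ->
    (\forall lambda \near +oo, N_union p lambda I \is a fin_num) /\
    (fun lambda => fine (N_union p lambda I))
      =O_ (+oo_R) (fun lambda => f_of h (lambda `^ (1 / p)))) /\
  (asymp_equiv (fun j => len (I j)) (fun j => g_of h j%:R) ->
    (\forall lambda \near +oo, N_union p lambda I \is a fin_num) /\
    (fun lambda => fine (N_union p lambda I)) =
      (fun lambda => zeta d / pi_p p `^ d * f_of h (lambda `^ (1 / p)))
      +o_ (+oo_R) (fun lambda => f_of h (lambda `^ (1 / p)))).
Proof.
have pi0 := pi_p_gt0 hp.
have p0 : 0 < 1 / p by rewrite divr_gt0// (lt_trans _ hp).
pose l j := len (I j) / pi_p p.
have l0 j : (0 < j)%N -> 0 <= l j.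
  by move=> /I_itv/len_gt0 lj; rewrite divr_ge0 ?(ltW lj) ?(ltW pi0).
(* Carries statements about large x over to large lambda, with x = lambda^(1/p). *)
have toy := cvg_powR_pinfty p0.
have pos : \forall lambda \near +oo_R, 0 < lambda.
  by apply: nbhs_pinfty_gt; exact: num_real.
have fE (x : R) : f_of h x = (h x^-1)^-1 by rewrite /f_of !div1r.
have hpos (x : R) : 0 < x -> 0 < h (x `^ (1 / p))^-1.
  by move=> x0; apply: (G_pos hh); rewrite invr_gt0 powR_gt0.
split.
  move=> [c [C [c0 C0 lg]]].
  have lC : \forall j \near \oo, l j <= C / pi_p p * g_of h j%:R.
    by apply: filterS lg => j [_]; rewrite /l mulrAC ler_pM2r ?invr_gt0.
  have := total_count_le hd hh l0 (divr_gt0 C0 pi0) ltr01 lC.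
  move=> /toy H; split.
    by apply: filterS2 pos H => x x0 [fx _]; rewrite N_unionE ?ltW.
  (* K = (C / pi_p)^d zeta(d) + 1 is the constant of the O. *)
  set K := _ + 1 in H.
  apply/eqOP; exists K; split; first exact: num_real.
  move=> k Kk; apply: filterS2 pos H => x x0 [fx hx].
  have N0 : 0 <= fine (total_count l (x `^ (1 / p))).
    by apply: fine_ge0; apply: nneseries_ge0 => *; rewrite lee_fin.
  rewrite (N_unionE hp I_itv (ltW x0)) fE ger0_norm// gtr0_norm ?invr_gt0 ?hpos//.
  by rewrite ler_pdivlMr ?hpos// mulrC (le_trans hx)// ltW.
move=> lg.
(* The limit 1/pi_p of the rescaled lengths produces the factor pi_p^-d. *)
have lg' : l j / g_of h j%:R @[j --> \oo] --> (pi_p p)^-1.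
  rewrite -[X in _ --> X]mulr1.
  have : (pi_p p)^-1 * (len (I j) / g_of h j%:R) @[j --> \oo] --> (pi_p p)^-1 * 1.
    exact: cvgMl_tmp.
  apply: cvg_trans; apply: near_eq_cvg.
  by apply: nearW => j; rewrite /l mulrCA mulrA.
have := total_count_cvg hd hh l0 _ lg'; rewrite invr_gt0 => /(_ pi0)[fin lim].
split.
  by apply: filterS2 pos (toy _ fin) => x x0 fx; rewrite N_unionE ?ltW.
(* As f = 1/h(1/x), multiplying the required bound e f by h(1/x) reduces it to the convergence in
   [lim]. *)
apply/eqaddoP => e e0.
move/cvgrPdist_le : lim => /(_ e e0) /toy H.
apply: filterS2 pos H => x x0.
have h0 := hpos x x0.
have -> : (pi_p p)^-1 `^ d * zeta d = zeta d / pi_p p `^ d.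
  by rewrite -[_^-1]powR_inv1 ?(ltW pi0)// -powRrM mulN1r powRN mulrC.
rewrite /= distrC => hx.
rewrite [X in `|X|](_ : _ = fine (N_union p x I) -
  zeta d / pi_p p `^ d * f_of h (x `^ (1 / p)))//.
rewrite (N_unionE hp I_itv (ltW x0)) fE.
rewrite [X in _ <= e * X]gtr0_norm ?invr_gt0// ler_pdivlMr//.
rewrite -[X in _ * X](gtr0_norm h0) -normrM mulrBl divfK ?gt_eqF//.
by rewrite [X in X - _]mulrC.
Qed.
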